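(* Let $m\ge 2$ be an integer, $0<p<1$, $q=1-p$ and $r=q/p$. The vertices of an $(m+1)$-gon are labeled $0,1,2,\ldots,m$ in clockwise order (with vertex $m+1$ identified with vertex $0$). A particle starts at $0$ and at each step moves to a neighboring vertex, going clockwise with probability $p$ or counterclockwise with probability $q$, the directions of successive movements being independent. Let $V$ be the number of steps needed to visit all vertices, let $L_i$ be the event that the last vertex to be visited is vertex $i$, and let $v_i=E[V\mid L_i]$ be the conditional expected number of moves needed to visit all vertices given that the last vertex visited is $i$. Then for $i=1,2,\ldots,m$, $$v_i=\begin{cases}\dfrac{1}{3}(m-1)(m+1)+(m+1-i)\,i & \text{if } r=1,\\[2mm] \dfrac{r+1}{r-1}\left[m+i-1-\dfrac{2}{r-1}+\dfrac{2m}{r^m-1}-(m+1)\dfrac{r^i-1}{r^{m+1}-1}\right] & \text{if } r\neq 1,\end{cases}$$ and $$E[V]=\begin{cases}\dfrac{m(m+1)}{2} & \text{if } r=1,\\[2mm] \dfrac{r+1}{r-1}\left[m-\dfrac{1}{r-1}-\dfrac{m^2}{r^m-1}+\dfrac{(m+1)^2}{r^{m+1}-1}\right] & \text{if } r\neq 1.\end{cases}$$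
   Context: The particle's position after $n$ steps is $Y_n=(X_1+\cdots+X_n) \bmod (m+1)$, where $X_1,X_2,\dots$ are i.i.d. with $P(X_k=1)=p$ and $P(X_k=-1)=q$. Vertex $0$ counts as visited at time $0$. The number of steps needed to visit all vertices is $V=\min\{n\ge 0:\{Y_0,\dots,Y_n\}=\{0,1,\dots,m\}\}$. The ''last vertex to be visited'' is the vertex whose first visit occurs latest, i.e. $L_i=\{Y_V=i\}$. *)

(* Defs.v *)
From HB Require Import structures.
From mathcomp Require Import all_boot all_order all_algebra finmap.
From mathcomp Require Import all_classical all_reals all_analysis.

Set Implicit Arguments.
Unset Strict Implicit.
Unset Printing Implicit Defensive.

Import Order.TTheory GRing.Theory Num.Theory.

Local Open Scope classical_set_scope.
Local Open Scope ring_scope.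

(* The integers carry the discrete sigma-algebra, so that {RV P >-> int} is the
   type of integer-valued random variables. *)
HB.instance Definition _ := isPointed.Build int 0.
HB.instance Definition _ := @isMeasurable.Build default_measure_display
  int (@discrete_measurable int) (@discrete_measurable0 int)
  (@discrete_measurableC int) (@discrete_measurableU int).

Definition mutually_independent {d d' : measure_display} {T : measurableType d}
    {T' : measurableType d'} {R : realType} (P : probability T R)
    (I : choiceType) (X : I -> {RV P >-> T'}) : Prop :=
  forall (J : {fset I}) (B : I -> set T'),
    (forall j, j \in J -> measurable (B j)) ->
    P (\bigcap_(j in [set` J]) (X j @^-1` B j)) =
    (\prod_(j <- J) P (X j @^-1` B j))%E.

(* E[V | A] for an event A of positive probability. *)
Definition cond_expectation {d : measure_display} {T : measurableType d}
    {R : realType} (P : probability T R) (A : set T) (V : T -> \bar R) : \bar R :=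
  ((\int[P]_(w in A) V w) / P A)%E.

Section walk.
Context {T : Type}.
Variables (m : nat) (X : nat -> T -> int).

(* X k is the (k+1)-st step, so that Y_n involves X 0, ..., X (n-1).  The
   remainder %% is the representative in {0, ..., m}, and the absolute value
   only turns it into a natural number. *)
Definition position (n : nat) (w : T) : nat :=
  `| ((\sum_(k < n) X k w) %% m.+1%:Z)%Z |%N.

Definition all_visited (n : nat) (w : T) : Prop :=
  [set position j w | j in `I_n.+1] = `I_m.+1.

(* The value is +oo if some vertex is never visited. *)
Definition cover_time {R : realType} (w : T) : \bar R :=
  ereal_inf [set n%:R%:E | n in [set n | all_visited n w]].

Definition last_visited (R : realType) (i : nat) : set T :=
  [set w | exists n : nat,
     @cover_time R w = n%:R%:E /\ position n w = i].

End walk.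

(* Main.v *)
Require Import Defs.
From HB Require Import structures.
From mathcomp Require Import all_boot all_order all_algebra finmap.
From mathcomp Require Import all_classical all_reals all_analysis.
From mathcomp Require Import measurable_realfun ring lra zify.

Set Implicit Arguments.
Unset Strict Implicit.
Unset Printing Implicit Defensive.

Import Order.TTheory GRing.Theory Num.Theory.
Import numFieldNormedType.Exports.

Local Open Scope classical_set_scope.
Local Open Scope ring_scope.

(** Fix a vertex [i] other than 0 and unroll the polygon on the line so that two
    consecutive copies of [i] are at heights 0 and [m.+1].  The walk starts from
    height [m.+1 - i], and [i] is the last vertex visited, at time [n], exactly
    when the walk first exits the heights [1], ..., [m] at time [n], having
    visited both [1] and [m], the neighbours of [i], before: a nearest-neighbour
    path that visits these two visits all heights in between
    ([first_covered_exit]).  So for each [i] the relevant process is a Markov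
    chain made of the height and of two flags that tell whether [1] and [m] have
    been visited; [exit_prob n] is the probability that this chain is absorbed
    with both flags set at time [n], and by independence of the steps it is the
    probability of covering at time [n] and at vertex [i] ([last_at_prob]).

    The sum over [n] of [exit_prob n] is the probability of [L i], and the sum
    of [n * exit_prob n] is the integral of [V] over [L i].  As functions of the
    state, these two sums [g] and [h] should satisfy
    [g y = p g (y+1) + q g (y-1)] and [h y = g y + p h (y+1) + q h (y-1)].
    For fixed flags this is a gambler's ruin problem, and the problems for
    different flags are linked by boundary conditions at heights [1] and [m]
    ([phase_system]).  It can be solved explicitly, first with both flags set,
    then with one, then with none: the solutions are [sym_mass],
    [sym_time], [asym_mass] and [asym_time].

    That the partial sums do converge to these solutions is seen by subtracting
    the equations: the difference obeys the same recursion, killed at the exit,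
    and a Lyapunov function of the height shows that it decays geometrically
    ([killed_bound], [exit_mass_cvg], [exit_time_cvg]).

    Finally [v_i] is [h / g] at height [m.+1 - i] with no flag set.  Summed over
    the heights [1], ..., [m], the masses [g] give 1, so [V] is almost surely
    finite, and the times [h] give its expectation ([cover_time_integral]). *)

(** * The walk with two flags, killed at exit *)

(** The linear system solved by a quantity [f lo hi y] that depends on the
    height [y] and on the phase: [lo] (resp. [hi]) records that height 1
    (resp. [m]) has been visited.  Within a phase [f] obeys a gambler's ruin
    equation with source [c]; reaching height 1 or [m] for the first time
    switches the phase, so that the solutions of two phases agree there; at the absorbing heights
    0 and [m.+1] the value is the success indicator if [b], and 0 otherwise.
    Height 0 is entered from height 1, which is why only [lo = true] matters
    there, and symmetrically at the top. *)
Record phase_system (R : realFieldType) (m : nat) (p q : R)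
    (f c : bool -> bool -> nat -> R) (b : bool) : Prop := PhaseSystem {
  phase_step : forall lo hi y, (0 < y <= m)%N ->
    f lo hi y = c lo hi y + p * f lo hi y.+1 + q * f lo hi y.-1;
  phase_lo : forall hi, f false hi 1%N = f true hi 1%N;
  phase_hi : forall lo, f lo false m = f lo true m;
  phase_bot : forall hi, f true hi 0%N = (b && hi)%:R;
  phase_top : forall lo, f lo true m.+1 = (b && lo)%:R }.

Section killed_walk.
Variables (R : realType) (m : nat) (p q : R).
Implicit Types (y n N : nat) (lo hi : bool).

Definition absorbed y := (y == 0)%N || (y == m.+1).

(** The probability, from height [y] with flags [lo] and [hi], of reaching an
    absorbing height at step [n] exactly, both heights 1 and [m] having been
    left by then: the flags are updated when a height is left. *)
Fixpoint exit_prob n y lo hi : R :=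
  if n is n'.+1 then
    if absorbed y then 0
    else p * exit_prob n' y.+1 (lo || (y == 1)%N) (hi || (y == m))
       + q * exit_prob n' y.-1 (lo || (y == 1)%N) (hi || (y == m))
  else (absorbed y && (lo && hi))%:R.

(** A family indexed by phases, seen as a function of the state: a height
    counts as visited as soon as the walk is there, although the flags
    register it one step later. *)
Definition state_value (f : bool -> bool -> nat -> R) (b : bool) y lo hi : R :=
  if absorbed y then (b && (lo && hi))%:R
  else f (lo || (y == 1)%N) (hi || (y == m)) y.

Lemma state_value_step f c b y lo hi :
  phase_system m p q f c b -> (0 < y <= m)%N ->
  state_value f b y lo hi = c (lo || (y == 1)%N) (hi || (y == m)) y
    + p * state_value f b y.+1 (lo || (y == 1)%N) (hi || (y == m))
    + q * state_value f b y.-1 (lo || (y == 1)%N) (hi || (y == m)).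
Proof.
move=> F yr; case/andP: (yr) => y_gt0 y_lem.
rewrite {1}/state_value ifN; last by rewrite /absorbed; lia.
rewrite (phase_step F) //; congr (_ + _ * _ + _ * _).
- rewrite /state_value /absorbed /= eqSS; case: (eqVneq y m) => [->|ym].
    by rewrite !orbT andbT (phase_top F).
  have -> : (y.+1 == 1)%N = false by lia.
  rewrite !orbF; case: (eqVneq y.+1 m) => [->|_]; last by rewrite orbF.
  by rewrite orbT; case: hi => //=; rewrite (phase_hi F).
- rewrite /state_value /absorbed; case: (eqVneq y 1%N) => [->|y1] /=.
    by rewrite orbT /= (phase_bot F).
  have -> : (y.-1 == 0)%N = false by lia.
  have -> : (y.-1 == m.+1)%N = false by lia.
  have -> : (y.-1 == m)%N = false by lia.
  rewrite !orbF /=; case: (eqVneq y.-1 1%N) => [->|_]; last by rewrite orbF.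
  by rewrite orbT; case: lo => //=; rewrite (phase_lo F).
Qed.

Lemma state_value_start f c b y : phase_system m p q f c b -> (0 < y <= m)%N ->
  state_value f b y false false = f false false y.
Proof.
move=> F yr; rewrite /state_value ifN /=; last by rewrite /absorbed; lia.
have flo hi : f (y == 1)%N hi y = f false hi y.
  by case: eqVneq => // ->; rewrite (phase_lo F).
by rewrite flo; case: eqVneq => // ->; rewrite (phase_hi F).
Qed.

Lemma exit_probS n y lo hi : (0 < y <= m)%N ->
  exit_prob n.+1 y lo hi =
    p * exit_prob n y.+1 (lo || (y == 1)%N) (hi || (y == m))
    + q * exit_prob n y.-1 (lo || (y == 1)%N) (hi || (y == m)).
Proof. by move=> yr /=; rewrite ifN //; rewrite /absorbed; lia. Qed.

Lemma exit_prob0 y lo hi : (0 < y <= m)%N -> exit_prob 0 y lo hi = 0.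
Proof.
by move=> yr /=; have -> : absorbed y = false by rewrite /absorbed; lia.
Qed.

Lemma exit_prob_absorbed n y lo hi : absorbed y -> exit_prob n.+1 y lo hi = 0.
Proof. by move=> /= ->. Qed.

Lemma sum_drop0 (F : nat -> R) N : F 0%N = 0 ->
  \sum_(n < N.+1) F n = \sum_(n < N) F n.+1.
Proof. by move=> F0; rewrite big_ord_recl F0 add0r; apply: eq_bigr. Qed.

Hypotheses (p0 : 0 < p) (q0 : 0 < q) (pq1 : p + q = 1).

(** Since [p * (2 / p) + q / (2 / p) >= 2], the function [(2 / p) ^+ y] grows
    by at least 1 in mean at each step, so that [lyapunov] decreases by at
    least 1 while staying below [survival_bound]: it contracts by the factor
    [survival_rate], whatever the flags. *)
Definition survival_bound := (2 / p) ^+ m.+1 + 1.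

Definition survival_rate := 1 - survival_bound^-1.

Definition lyapunov y := survival_bound - (2 / p) ^+ y.

Lemma one_lt_two_div_p : 1 < 2 / p.
Proof. by rewrite ltr_pdivlMr // mul1r; move: q0 pq1; lra. Qed.

Lemma survival_bound_gt1 : 1 < survival_bound.
Proof.
rewrite /survival_bound ltrDr exprn_gt0 //.
exact: lt_trans one_lt_two_div_p.
Qed.

Lemma survival_rateP : 0 < survival_rate < 1.
Proof.
have b1 := survival_bound_gt1; have b0 : 0 < survival_bound by lra.
rewrite /survival_rate subr_gt0 invf_lt1 // b1 /=.
by rewrite ltrBlDr ltrDl invr_gt0.
Qed.

Lemma lyapunov_ge1 y : (y <= m.+1)%N -> 1 <= lyapunov y.
Proof.
move=> ym; rewrite /lyapunov /survival_bound.
suff : (2 / p) ^+ y <= (2 / p) ^+ m.+1 by lra.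
by rewrite ler_eXn2l // one_lt_two_div_p.
Qed.

Lemma lyapunov_step y : (0 < y <= m)%N ->
  p * lyapunov y.+1 + q * lyapunov y.-1 <= survival_rate * lyapunov y.
Proof.
case: y => [//|y] _ /=; rewrite /lyapunov /survival_rate.
have b1 := survival_bound_gt1; have pN0 := lt0r_neq0 p0.
have b0 : survival_bound != 0 by lra.
set K := survival_bound in b1 b0 *; have l1 := one_lt_two_div_p.
have Y1 : 1 <= (2 / p) ^+ y by rewrite exprn_ege1 // ltW.
rewrite !exprS; set Y := _ ^+ y in Y1 *; clearbody Y K.
have -> : p * (K - 2 / p * (2 / p * Y)) + q * (K - Y) =
    (p + q) * K - 2 * (2 / p * Y) - q * Y by field.
have -> : (1 - K^-1) * (K - 2 / p * Y) = K - 1 - 2 / p * Y + (2 / p * Y) / K.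
  by field; rewrite b0 pN0.
rewrite pq1 mul1r.
have Y0 := le_trans ler01 Y1.
have : 1 <= 2 / p * Y by rewrite (le_trans Y1) // ler_peMl // ltW.
set Z := 2 / p * Y => Z1.
have : 0 <= Z / K by rewrite divr_ge0 //; lra.
have : 0 <= q * Y by rewrite mulr_ge0 // ltW.
by lra.
Qed.

(** Comparison with the Lyapunov function: a quantity killed at the absorbing
    heights and satisfying the one-step recursion with source [v] is at most
    [c N] times [lyapunov], as soon as the scalar sequence [c] dominates the
    recursion obtained by contracting with [survival_rate]. *)
Lemma killed_bound (u v : nat -> nat -> bool -> bool -> R) (c e : nat -> R) :
  (forall N, 0 <= c N) ->
  (forall N y lo hi, absorbed y -> u N y lo hi = 0) ->
  (forall N y lo hi, (0 < y <= m)%N ->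
     u N.+1 y lo hi = v N y lo hi
       + p * u N y.+1 (lo || (y == 1)%N) (hi || (y == m))
       + q * u N y.-1 (lo || (y == 1)%N) (hi || (y == m))) ->
  (forall N y lo hi, (y <= m.+1)%N -> `|v N y lo hi| <= e N * lyapunov y) ->
  (forall y lo hi, (y <= m.+1)%N -> `|u 0%N y lo hi| <= c 0%N * lyapunov y) ->
  (forall N, e N + survival_rate * c N <= c N.+1) ->
  forall N y lo hi, (y <= m.+1)%N -> `|u N y lo hi| <= c N * lyapunov y.
Proof.
move=> c0 uabs urec vbound ubase crec; elim=> [//|N IH] y lo hi ym.
have [yabs|yN] := boolP (absorbed y).
  rewrite uabs // normr0 mulr_ge0 //.
  exact: le_trans ler01 (lyapunov_ge1 ym).
have yr : (0 < y <= m)%N by move: yN; rewrite /absorbed; lia.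
rewrite urec //; apply: le_trans (ler_normD _ _) _.
apply: le_trans (lerD (ler_normD _ _) (lexx _)) _.
rewrite !normrM (gtr0_norm p0) (gtr0_norm q0).
have y1 : (y.+1 <= m.+1)%N by lia.
have y2 : (y.-1 <= m.+1)%N by lia.
have Hp := IH _ (lo || (y == 1)%N) (hi || (y == m)) y1.
have Hq := IH _ (lo || (y == 1)%N) (hi || (y == m)) y2.
have := lerD (lerD (vbound N y lo hi ym) (ler_wpM2l (ltW p0) Hp))
  (ler_wpM2l (ltW q0) Hq).
move=> /le_trans; apply.
have := ler_wpM2l (c0 N) (lyapunov_step yr).
have := ler_wpM2r (le_trans ler01 (lyapunov_ge1 ym)) (crec N).
rewrite mulrDl => ? ?; rewrite -addrA.
have -> : p * (c N * lyapunov y.+1) + q * (c N * lyapunov y.-1) =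
  c N * (p * lyapunov y.+1 + q * lyapunov y.-1) by ring.
by nra.
Qed.

Lemma lyapunov_dominates (f : nat -> bool -> bool -> R) :
  exists2 C, 0 <= C &
    forall y lo hi, (y <= m.+1)%N -> `|f y lo hi| <= C * lyapunov y.
Proof.
exists (\sum_(y < m.+2) \sum_(lo : bool) \sum_(hi : bool) `|f y lo hi|).
  by do 3!apply: sumr_ge0 => ? _.
move=> y lo hi ym.
rewrite (bigD1 (Ordinal (ym : (y < m.+2)%N))) //=.
rewrite (bigD1 lo) //= (bigD1 hi) //=.
set a := `|_|; set A := _ + _.
have aA : a <= A.
  rewrite /A -!addrA lerDl !addr_ge0 //;
    by repeat (apply: sumr_ge0 => ? _).
have A0 : 0 <= A by rewrite (le_trans _ aA) // normr_ge0.
by rewrite (le_trans aA) // ler_peMr // lyapunov_ge1.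
Qed.

(** The gap between the solution of the linear system and the partial sum up
    to time [N]; by subtraction of the recursions it is itself a killed
    quantity, to which [killed_bound] applies. *)
Definition mass_defect g N y lo hi :=
  state_value g true y lo hi - \sum_(n < N.+1) exit_prob n y lo hi.

Definition time_defect h N y lo hi :=
  state_value h false y lo hi - \sum_(n < N.+1) n%:R * exit_prob n y lo hi.

Lemma mass_defect_bound g :
  phase_system m p q g (fun _ _ _ => 0) true ->
  exists2 C, 0 <= C & forall N y lo hi, (y <= m.+1)%N ->
    `|mass_defect g N y lo hi| <= C * survival_rate ^+ N * lyapunov y.
Proof.
move=> sys; have [C C0 HC] := lyapunov_dominates (mass_defect g 0).
have /andP[rho0 rho1] := survival_rateP.
exists C => //; apply: (@killed_bound _ (fun _ _ _ _ => 0)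
  (fun N => C * survival_rate ^+ N) (fun _ => 0)).
- by move=> N; rewrite mulr_ge0 // exprn_ge0 // ltW.
- move=> N y lo hi yabs; rewrite /mass_defect /state_value yabs.
  rewrite big_ord_recl big1.
    by rewrite addr0 /= yabs subrr.
  by move=> i _; rewrite exit_prob_absorbed.
- move=> N y lo hi yr; rewrite /mass_defect (state_value_step _ _ sys yr).
  rewrite (@sum_drop0 (fun n => exit_prob n y lo hi)) ?exit_prob0 //.
  under eq_bigr do rewrite exit_probS //.
  by rewrite big_split /= -!mulr_sumr; ring.
- by move=> *; rewrite normr0 mul0r.
- by move=> y lo hi ym; rewrite expr0 mulr1; apply: HC.
- by move=> N; rewrite add0r exprS mulrCA.
Qed.

(** Counting one more step adds the exit mass to the exit time, so the source
    of the recursion of the time defect is the mass defect, of order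
    [survival_rate ^+ N]; the resulting [N * survival_rate ^+ N] is absorbed
    by a slightly larger rate. *)
Lemma time_defect_bound g h :
  phase_system m p q g (fun _ _ _ => 0) true ->
  phase_system m p q h g false ->
  exists C, exists2 s, 0 < s < 1 & forall N y lo hi, (y <= m.+1)%N ->
    `|time_defect h N y lo hi| <= C * s ^+ N * lyapunov y.
Proof.
move=> gsys hsys; have [C C0 HC] := mass_defect_bound gsys.
have [D D0 HD] := lyapunov_dominates (time_defect h 0).
have /andP[rho0 rho1] := survival_rateP.
set rho := survival_rate in rho0 rho1 HC *.
(* Any rate strictly between [rho] and 1 would do; [E] bounds the
   initial defect by its first term and absorbs the source by its second. *)
pose s := (1 + rho) / 2; have s0 : 0 < s by rewrite /s; lra.
have rhos : rho < s by rewrite /s; lra.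
pose E := D + C * rho / (s - rho).
have E0 : 0 <= C * rho / (s - rho).
  by apply: divr_ge0; [apply: mulr_ge0; last exact: ltW|rewrite subr_ge0 ltW].
have s1 : s < 1 by rewrite /s; lra.
exists E, s; first by rewrite s0 s1.
apply: (@killed_bound _ (fun N => mass_defect g N.+1)
  (fun N => E * s ^+ N) (fun N => C * rho ^+ N.+1)).
- by move=> N; rewrite mulr_ge0 ?addr_ge0 // exprn_ge0 // ltW.
- move=> N y lo hi yabs; rewrite /time_defect /state_value yabs.
  rewrite big_ord_recl big1.
    by rewrite mul0r addr0 subrr.
  by move=> i _; rewrite exit_prob_absorbed // mulr0.
- move=> N y lo hi yr; rewrite /time_defect /mass_defect.
  rewrite (state_value_step _ _ hsys yr).
  rewrite (@sum_drop0 (fun n => n%:R * exit_prob n y lo hi)) ?mul0r //.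
  rewrite (@sum_drop0 (fun n => exit_prob n y lo hi)) ?exit_prob0 //.
  have -> : state_value g true y lo hi =
      g (lo || (y == 1)%N) (hi || (y == m)) y.
    by rewrite /state_value ifN // /absorbed; lia.
  rewrite (eq_bigr (fun n : 'I_N.+1 => exit_prob n.+1 y lo hi
    + p * (n%:R * exit_prob n y.+1 (lo || (y == 1)%N) (hi || (y == m)))
    + q * (n%:R * exit_prob n y.-1 (lo || (y == 1)%N) (hi || (y == m))))).
    by rewrite !big_split /= -!mulr_sumr; ring.
  by move=> n _; rewrite -(natr1 n) exit_probS //; ring.
- by move=> N y lo hi ym; apply: HC.
- move=> y lo hi ym; rewrite expr0 mulr1; apply: le_trans (HD _ _ _ ym) _.
  by rewrite ler_wpM2r ?lerDl // (le_trans ler01) // lyapunov_ge1.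
- move=> N; rewrite !exprS.
  have rs : rho ^+ N <= s ^+ N by apply: lerXn2r; rewrite ?nnegrE; exact: ltW.
  have -> : E * (s * s ^+ N) =
      rho * (E * s ^+ N) + (D * (s - rho) + C * rho) * s ^+ N.
    by rewrite /E; field; rewrite lt0r_neq0 // subr_gt0.
  rewrite addrC lerD2l; apply: (@le_trans _ _ (C * rho * s ^+ N)).
    by rewrite mulrA ler_wpM2l // mulr_ge0 // ltW.
  rewrite ler_wpM2r ?exprn_ge0 ?(ltW s0) // lerDr mulr_ge0 // subr_ge0 ltW //.
Qed.

Lemma geometric_defect_cvg (S : R^nat) (l C s : R) : 0 < s < 1 ->
  (forall N, `|l - S N.+1| <= C * s ^+ N) -> S @ \oo --> l.
Proof.
move=> /andP[s0 s1] H; rewrite -cvg_shiftS.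
have Cs : (fun N => C * s ^+ N) @ \oo --> (0 : R).
  rewrite -[X in _ --> X](mulr0 C); apply: cvgM; first exact: cvg_cst.
  by apply: cvg_expr; rewrite gtr0_norm.
apply/cvgrPdist_le => eps eps0; move/cvgrPdist_le: Cs => /(_ _ eps0) Cs.
near=> N; apply: le_trans (H N) _.
apply: le_trans (ler_norm _) _; rewrite -normrN -[- _]add0r.
by near: N; exact: Cs.
Unshelve. all: end_near. Qed.

Lemma exit_mass_cvg g y lo hi : phase_system m p q g (fun _ _ _ => 0) true ->
  (y <= m.+1)%N ->
  (fun N => \sum_(n < N) exit_prob n y lo hi) @ \oo -->
    state_value g true y lo hi.
Proof.
move=> sys ym; have [C _ HC] := mass_defect_bound sys.
apply: (@geometric_defect_cvg _ _ (C * lyapunov y) _ survival_rateP) => N.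
by rewrite mulrAC; exact: HC.
Qed.

Lemma exit_time_cvg g h y lo hi : phase_system m p q g (fun _ _ _ => 0) true ->
  phase_system m p q h g false -> (y <= m.+1)%N ->
  (fun N => \sum_(n < N) n%:R * exit_prob n y lo hi) @ \oo -->
    state_value h false y lo hi.
Proof.
move=> gsys hsys ym; have [C [s s01 HC]] := time_defect_bound gsys hsys.
apply: (@geometric_defect_cvg _ _ (C * lyapunov y) _ s01) => N.
by rewrite mulrAC; exact: HC.
Qed.

End killed_walk.

(** * Explicit masses and times *)

Lemma expr_neq1 (R : realFieldType) (r : R) n :
  0 < r -> r != 1 -> (0 < n)%N -> r ^+ n - 1 != 0.
Proof. by move=> r0 r1 n0; rewrite subr_eq0 pexpr_eq1 // ltW. Qed.

Ltac nonzero r0 r1 m0 :=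
  have rN0 := lt0r_neq0 r0;
  have r1N0 : r - 1 != 0 by [rewrite subr_eq0];
  have rp1N0 : r + 1 != 0 by [rewrite lt0r_neq0 // addr_gt0];
  have amN0 := expr_neq1 r0 r1 m0;
  have aMN0 : r * r ^+ m - 1 != 0 by [rewrite -exprS; apply: expr_neq1].

Section closed_forms.
Variables (R : realFieldType) (m : nat).
Implicit Types (y : nat) (lo hi : bool) (r : R).

(** The solutions for [p = q]: in each phase the mass is affine in the height,
    and the time solves a second-order difference equation with this mass as
    source, hence is a polynomial of degree at most 3. *)
Definition sym_mass lo hi y : R :=
  match lo, hi with
  | true, true => 1
  | true, false => y%:R / m%:R
  | false, true => (m%:R + 1 - y%:R) / m%:R
  | false, false => m%:R^-1
  end.

Definition sym_time lo hi y : R :=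
  match lo, hi with
  | true, true => y%:R * (m%:R + 1 - y%:R)
  | true, false =>
      y%:R * (1 + m%:R / 3) - y%:R ^+ 3 / (3 * m%:R)
  | false, true =>
      (m%:R + 1 - y%:R) * (1 + m%:R / 3)
      - (m%:R + 1 - y%:R) ^+ 3 / (3 * m%:R)
  | false, false =>
      m%:R^-1 * (3^-1 * (m%:R - 1) * (m%:R + 1)
                 + y%:R * (m%:R + 1 - y%:R))
  end.

Lemma sym_mass_system : (0 < m)%N ->
  phase_system m 2^-1 2^-1 sym_mass (fun _ _ _ => 0) true.
Proof.
move=> m0; have mN0 : m%:R != 0 :> R by rewrite pnatr_eq0 -lt0n.
split.
- move=> lo hi [//|y] _ /=; case: lo; case: hi => /=;
  by rewrite -?[y.+2]addn2 -?[y.+1]addn1 ?natrD; field.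
- by case=> /=; field.
- by case=> /=; field.
- by case=> /=; field.
- by case=> /=; rewrite -?[m.+1]addn1 ?natrD; field.
Qed.

Lemma sym_time_system : (0 < m)%N ->
  phase_system m 2^-1 2^-1 sym_time sym_mass false.
Proof.
move=> m0; have mN0 : m%:R != 0 :> R by rewrite pnatr_eq0 -lt0n.
split.
- move=> lo hi [//|y] _ /=; case: lo; case: hi => /=;
  by rewrite -?[y.+2]addn2 -?[y.+1]addn1 ?natrD; field.
- by case=> /=; field.
- by case=> /=; field.
- by case=> /=; field.
- by case=> /=; rewrite -?[m.+1]addn1 ?natrD; field.
Qed.

(** The solutions for [p <> q], where [r = q / p]: the harmonic functions are
    spanned by [1] and [r ^+ y]; a source [1] contributes a multiple of [y], a
    source [r ^+ y] a multiple of [y * r ^+ y], and the remaining constants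
    are fixed by the boundary conditions. *)
Definition asym_mass r lo hi y : R :=
  match lo, hi with
  | true, true => 1
  | true, false => (r ^+ y - 1) / (r ^+ m - 1)
  | false, true => (r ^+ m.+1 - r ^+ y) / (r ^+ m.+1 - r)
  | false, false => r ^+ y / r * (r - 1) / (r ^+ m - 1)
  end.

Definition asym_time r lo hi y : R :=
  let M := m%:R + 1 in
  let a := r ^+ m in
  let Y := r ^+ y in
  (r + 1) / (r - 1) *
  match lo, hi with
  | true, true => y%:R - M * ((Y - 1) / (r * a - 1))
  | true, false =>
      - (y%:R * (Y + 1)
         + (M * (a - 1) / (r * a - 1) - 2 * m%:R * a / (a - 1)) * (Y - 1))
      / (a - 1)
  | false, true =>
      (y%:R * (r * a + Y) - 2 * M * r * a
       + ((2 - 2 * M * a) / (a - 1) + M * (r - 1) / (r * a - 1))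
         * (Y - r * a)) / (r * a - r)
  | false, false =>
      (r - 1) / (r * (a - 1)) *
      (Y * (2 * m%:R + 2 * m%:R / (a - 1) + M / (r * a - 1) - 2 / (r - 1)
            - y%:R)
       - M * r * a / (r * a - 1))
  end.

Lemma asym_mass_system r : 0 < r -> r != 1 -> (0 < m)%N ->
  phase_system m (1 + r)^-1 (r / (1 + r)) (asym_mass r) (fun _ _ _ => 0) true.
Proof.
move=> r0 r1 m0; nonzero r0 r1 m0; rewrite [1 + r]addrC.
have bN0 : r * r ^+ m - r != 0.
  by rewrite -[X in _ - X]mulr1 -mulrBr mulf_neq0.
split.
- move=> lo hi [//|y] _ /=; rewrite /asym_mass !exprS.
  by case: lo; case: hi => /=; field; rewrite ?rN0 ?rp1N0 ?amN0 ?bN0.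
- by case=> /=; rewrite ?exprS ?expr0; field; rewrite ?rN0 ?amN0 ?bN0.
- by case=> /=; rewrite ?exprS; field; rewrite ?rN0 ?amN0 ?bN0.
- by case=> /=; rewrite ?expr0; field.
- by case=> /=; rewrite ?exprS; field; rewrite ?rN0 ?amN0 ?bN0.
Qed.

Lemma asym_time_system r : 0 < r -> r != 1 -> (0 < m)%N ->
  phase_system m (1 + r)^-1 (r / (1 + r)) (asym_time r) (asym_mass r) false.
Proof.
move=> r0 r1 m0; nonzero r0 r1 m0; rewrite [1 + r]addrC.
have bN0 : r * r ^+ m - r != 0.
  by rewrite -[X in _ - X]mulr1 -mulrBr mulf_neq0.
have nz := (rN0, rp1N0, r1N0, amN0, aMN0, bN0).
have Sn n : n.+1%:R = n%:R + 1 :> R by rewrite -natr1.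
split.
- move=> lo hi [//|y] _; rewrite /asym_mass /asym_time !exprS !Sn.
  by case: lo; case: hi => /=; field; rewrite ?nz.
- by case; rewrite /asym_time /= ?exprS ?expr0; field; rewrite ?nz.
- by case; rewrite /asym_time /= ?exprS; field; rewrite ?nz.
- by case; rewrite /asym_time /= ?expr0; field; rewrite ?nz.
- by case; rewrite /asym_time /= ?exprS ?Sn; field; rewrite ?nz.
Qed.

Lemma sum_geometric r k : r - 1 != 0 ->
  \sum_(j < k) r ^+ j = (r ^+ k - 1) / (r - 1).
Proof. by move=> r1; rewrite subrX1 mulrC mulKf. Qed.

Lemma sum_arith_geometric r k : r - 1 != 0 ->
  \sum_(j < k) j.+1%:R * r ^+ j =
  k%:R * r ^+ k / (r - 1) - (r ^+ k - 1) / (r - 1) ^+ 2.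
Proof.
move=> r1; elim: k => [|k IH]; first by rewrite big_ord0 expr0; ring.
by rewrite big_ord_recr /= IH (exprS r k) -(natr1 k); field.
Qed.

Lemma sum_sym_mass : (0 < m)%N ->
  \sum_(j < m) sym_mass false false j.+1 = 1.
Proof.
move=> m0; rewrite /sym_mass sumr_const card_ord -[LHS]mulr_natl mulfV //.
by rewrite pnatr_eq0 -lt0n.
Qed.

Lemma sum_sym_time : (0 < m)%N ->
  \sum_(j < m) sym_time false false j.+1 = m%:R * (m%:R + 1) / 2.
Proof.
move=> m0; have mN0 : m%:R != 0 :> R by rewrite pnatr_eq0 -lt0n.
rewrite /sym_time -mulr_sumr big_split /= sumr_const card_ord.
rewrite -(mulr_natl (_ * _) m).
have -> k : \sum_(j < k) j.+1%:R * (m%:R + 1 - j.+1%:R) =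
    (m%:R + 1) * (k%:R * (k%:R + 1) / 2)
    - k%:R * (k%:R + 1) * (2 * k%:R + 1) / 6 :> R.
  elim: k => [|k IH]; first by rewrite big_ord0; ring.
  by rewrite big_ord_recr /= IH -(natr1 k); field.
by field.
Qed.

Lemma sum_asym_mass r : 0 < r -> r != 1 -> (0 < m)%N ->
  \sum_(j < m) asym_mass r false false j.+1 = 1.
Proof.
move=> r0 r1 m0; nonzero r0 r1 m0.
under eq_bigr do rewrite /asym_mass exprS.
rewrite (eq_bigr (fun j : 'I_m => r ^+ j * ((r - 1) / (r ^+ m - 1)))).
  by rewrite -mulr_suml sum_geometric //; field; rewrite r1N0 amN0.
by move=> j _; field; rewrite rN0 amN0.
Qed.

Lemma sum_asym_time r : 0 < r -> r != 1 -> (0 < m)%N ->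
  \sum_(j < m) asym_time r false false j.+1 =
  (r + 1) / (r - 1) *
    (m%:R - (r - 1)^-1 - m%:R ^+ 2 / (r ^+ m - 1)
     + (m%:R + 1) ^+ 2 / (r ^+ m.+1 - 1)).
Proof.
move=> r0 r1 m0; nonzero r0 r1 m0.
rewrite /asym_time -mulr_sumr -mulr_sumr (exprS r m).
set A := (_ + _ - 2 / _); set B := (_ / (_ - 1)) in A *.
rewrite (eq_bigr (fun j : 'I_m => r ^+ j * (r * A) - r * (j.+1%:R * r ^+ j)
   - (m%:R + 1) * r * r ^+ m / (r * r ^+ m - 1))); last first.
  by move=> j _; rewrite exprS; ring.
rewrite !sumrB -mulr_suml -mulr_sumr sum_geometric // sum_arith_geometric //.
rewrite sumr_const card_ord -(mulr_natl (_ * _) m) /A /B.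
by field; rewrite ?rN0 ?rp1N0 ?r1N0 ?amN0 ?aMN0.
Qed.

End closed_forms.

Section conditional_values.
Variables (R : realFieldType) (m i : nat).
Hypothesis im : (1 <= i <= m)%N.

Let m0 : (0 < m)%N. Proof. by move: im; lia. Qed.

Lemma sym_conditional_time :
  sym_time R m false false (m.+1 - i) / sym_mass R m false false (m.+1 - i) =
  3^-1 * (m%:R - 1) * (m%:R + 1) + (m%:R + 1 - i%:R) * i%:R.
Proof.
have mN0 : m%:R != 0 :> R by rewrite pnatr_eq0 -lt0n.
have iM : (i <= m.+1)%N by move: im; lia.
by rewrite /sym_time /sym_mass natrB // -(natr1 m); field.
Qed.

Lemma asym_mass_gt0 (r : R) : 0 < r -> r != 1 ->
  0 < asym_mass m r false false (m.+1 - i).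
Proof.
move=> r0 r1; rewrite /asym_mass -mulrA; apply: mulr_gt0.
  by rewrite divr_gt0 ?exprn_gt0.
have [r_lt1|r_gt1|rE] := ltgtP r 1; last by rewrite rE eqxx in r1.
  rewrite -mulrNN -invrN !opprB divr_gt0 ?subr_gt0 //.
  by rewrite exprn_ilt1 ?ltW // -lt0n.
by rewrite divr_gt0 ?subr_gt0 // exprn_egt1 // -lt0n.
Qed.

Lemma asym_conditional_time (r : R) : 0 < r -> r != 1 ->
  asym_time m r false false (m.+1 - i) / asym_mass m r false false (m.+1 - i) =
  (r + 1) / (r - 1) *
    (m%:R + i%:R - 1 - 2 / (r - 1) + 2 * m%:R / (r ^+ m - 1)
     - (m%:R + 1) * ((r ^+ i - 1) / (r ^+ m.+1 - 1))).
Proof.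
move=> r0 r1; nonzero r0 r1 m0; rewrite /asym_time /asym_mass (exprS r m).
have iM : (i <= m.+1)%N by move: im; lia.
rewrite natrB // -(natr1 m).
have Y0 : r ^+ (m.+1 - i) != 0 by rewrite expf_neq0.
have -> : r ^+ i = r * r ^+ m / r ^+ (m.+1 - i).
  by rewrite -exprS -[in X in X / _](subnKC iM) exprD mulfK.
by field; rewrite ?rN0 ?rp1N0 ?r1N0 ?amN0 ?aMN0 ?Y0.
Qed.

End conditional_values.

(** * Covering paths and first exits *)

Section paths.
Variable m : nat.
Implicit Types (x : nat -> int) (y n j k v i : nat) (lo hi : bool).

(** The walk unrolled on the line, started from height [y]. *)
Definition height y x j : int := y%:Z + \sum_(k < j) x k.

Lemma height0 y x : height y x 0 = y%:Z.
Proof. by rewrite /height big_ord0 addr0. Qed.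

Lemma heightSr y x j : height y x j.+1 = height y x j + x j.
Proof. by rewrite /height big_ord_recr addrA. Qed.

Lemma heightSl y y' x j : y'%:Z = y%:Z + x 0%N ->
  height y x j.+1 = height y' (fun k => x k.+1) j.
Proof. by move=> yy'; rewrite /height big_ord_recl addrA -yy'. Qed.

(** The event whose probability is [exit_prob], in the same recursive form. *)
Fixpoint accept n x y lo hi : bool :=
  if n is n'.+1 then
    ~~ absorbed m y &&
    ((x 0%N == 1) && accept n' (fun k => x k.+1) y.+1
       (lo || (y == 1)%N) (hi || (y == m)) ||
     (x 0%N == -1) && accept n' (fun k => x k.+1) y.-1
       (lo || (y == 1)%N) (hi || (y == m)))
  else absorbed m y && (lo && hi).

Definition unit_steps n x := forall k, (k < n)%N -> x k = 1 \/ x k = -1.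

(** What [accept] says of the whole path when its steps are 1 or -1. *)
Definition first_exit n x y lo hi :=
  [/\ forall j, (j < n)%N -> 0 < height y x j < m.+1%:Z,
      height y x n = 0 \/ height y x n = m.+1%:Z,
      lo \/ exists2 j, (j < n)%N & height y x j = 1 &
      hi \/ exists2 j, (j < n)%N & height y x j = m%:Z].

Lemma first_exitS n x y y' lo hi : ~~ absorbed m y -> (y <= m)%N ->
  y'%:Z = y%:Z + x 0%N ->
  first_exit n (fun k => x k.+1) y' (lo || (y == 1)%N) (hi || (y == m)) <->
  first_exit n.+1 x y lo hi.
Proof.
move=> yN ym yy'.
have y_gt0 : (0 < y)%N by move: yN; rewrite /absorbed; lia.
have hS := heightSl _ yy'.
split=> -[H1 H2 H3 H4]; split.
- by case=> [_|j jn]; rewrite ?height0 ?hS; [lia|exact: H1].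
- by rewrite hS.
- case: H3 => [/orP[->|/eqP y1]|[j jn Hj]]; [by left| |]; right.
    by exists 0%N => //; rewrite height0 y1.
  by exists j.+1 => //; rewrite hS.
- case: H4 => [/orP[->|/eqP y1]|[j jn Hj]]; [by left| |]; right.
    by exists 0%N => //; rewrite height0 y1.
  by exists j.+1 => //; rewrite hS.
- by move=> j jn; rewrite -hS; exact: H1.
- by rewrite -hS.
- case: H3 => [->|[[|j] jn Hj]]; [by left| |].
    by left; move: Hj; rewrite height0 => -[->]; rewrite orbT.
  by right; exists j => //; rewrite -hS.
- case: H4 => [->|[[|j] jn Hj]]; [by left| |].
    by left; move: Hj; rewrite height0 => -[->]; rewrite eqxx orbT.
  by right; exists j => //; rewrite -hS.
Qed.

Lemma acceptP n x y lo hi : (y <= m.+1)%N -> unit_steps n x ->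
  accept n x y lo hi <-> first_exit n x y lo hi.
Proof.
elim: n x y lo hi => [|n IH] x y lo hi ym xs.
  rewrite /accept /first_exit height0 /absorbed; split.
    move=> /andP[/orP[]/eqP -> /andP[-> ->]]; split=> //; try by left.
    by right.
  move=> [_ H2 [->|[]//] [->|[]//]]; rewrite !andbT.
  by case: H2 => -[->]; rewrite ?eqxx ?orbT.
have xs' : unit_steps n (fun k => x k.+1) by move=> k kn; apply: xs.
have [yabs|yN] := boolP (absorbed m y).
  rewrite /= yabs; split=> // -[/(_ 0%N isT)]; rewrite height0.
  by move: yabs; rewrite /absorbed; lia.
have {}ym : (y <= m)%N by move: yN; rewrite /absorbed; lia.
have y_gt0 : (0 < y)%N by move: yN; rewrite /absorbed; lia.
rewrite /= yN /=; case: (xs 0%N isT) => x0; rewrite x0 /=.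
  rewrite orbF IH //; apply: first_exitS => //; rewrite x0; lia.
rewrite IH //; last by lia.
by apply: first_exitS => //; rewrite x0; lia.
Qed.

Lemma unit_steps_ivt (f : nat -> int) a b (u : int) : (a <= b)%N ->
  (forall j, (a <= j < b)%N -> f j.+1 = f j + 1 \/ f j.+1 = f j - 1) ->
  f a <= u <= f b -> exists2 j, (a <= j <= b)%N & f j = u.
Proof.
elim: b => [|b IH] ab fs ub.
  by case: a ab fs ub => // _ _ ub; exists 0%N => //; lia.
have [aE|ab'] := eqVneq a b.+1.
  by exists a; [lia|move: ub; rewrite -aE; lia].
have [ufb|ufb] := lerP u (f b).
  have ab1 : (a <= b)%N by lia.
  have fs1 j : (a <= j < b)%N -> f j.+1 = f j + 1 \/ f j.+1 = f j - 1.
    by move=> jb; apply: fs; lia.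
  by have [|j jb <-] := IH ab1 fs1; [lia|exists j => //; lia].
have ab1 : (a <= b < b.+1)%N by lia.
by exists b.+1; [lia|have := fs b ab1; lia].
Qed.

(** A path with unit steps between two heights, in either order of time, takes
    every value in between. *)
Lemma heights_between (f : nat -> int) n a b (u v w : int) :
  (forall j, (j < n)%N -> f j.+1 = f j + 1 \/ f j.+1 = f j - 1) ->
  (a < n)%N -> (b < n)%N -> f a = u -> f b = w -> u <= v <= w ->
  exists2 j, (j < n)%N & f j = v.
Proof.
move=> fs an bn fa fb uvw; have [ab|ba] := leqP a b.
  have [||j jb <-] := @unit_steps_ivt f a b v ab.
  - by move=> j jb; apply: fs; lia.
  - by rewrite fa fb.
  - by exists j => //; lia.
have [||j jb fj] := @unit_steps_ivt (fun j => - f j) b a (- v) (ltnW ba).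
- move=> j jb; have jn : (j < n)%N by lia.
  by have := fs j jn; lia.
- by rewrite fa fb; lia.
- by exists j; lia.
Qed.

Section position.
Variables (T : Type) (X : nat -> T -> int) (w : T).

(** Heights 0 and [m.+1] both stand for the vertex [i], and height [y] for the
    vertex [y + i] modulo [m.+1]; vertex 0 is at height [m.+1 - i]. *)
Lemma position_height i j : (i <= m.+1)%N ->
  0 <= height (m.+1 - i) (X^~ w) j ->
  position m X j w = ((`|height (m.+1 - i) (X^~ w) j| + i) %% m.+1)%N.
Proof.
move=> im h0; rewrite /position; set S := \sum_(_ < _) _.
have hE : (`|height (m.+1 - i) (X^~ w) j| + i)%:Z = S + m.+1%:Z.
  by rewrite PoszD gez0_abs // /height -/S; lia.
have -> : (S %% m.+1%:Z)%Z =
    ((`|height (m.+1 - i) (X^~ w) j| + i)%:Z %% m.+1%:Z)%Z.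
  by rewrite hE modzDr.
by rewrite modz_nat absz_nat.
Qed.

Lemma position_lt j : (position m X j w < m.+1)%N.
Proof.
rewrite /position; set S := \sum_(_ < _) _.
have := ltz_pmod S (isT : 0 < m.+1%:Z); have := modz_ge0 S (isT : m.+1%:Z != 0).
by lia.
Qed.

Lemma all_visitedP n : all_visited m X n w <->
  forall v, (v <= m)%N -> exists2 j, (j <= n)%N & position m X j w = v.
Proof.
rewrite /all_visited; split=> [H v vm|H].
  have : `I_m.+1 v by [].
  by rewrite -H => -[j /= jn <-]; exists j.
apply/seteqP; split=> [_ [j _ <-]|v /= vm]; first exact: position_lt.
by have [j jn <-] := H _ vm; exists j.
Qed.

Definition first_covered n :=
  all_visited m X n w /\ forall k, all_visited m X k w -> (n <= k)%N.

(** If vertex [i] is the last one, then its two neighbours, at heights 1 and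
    [m], are visited before the first visit of [i], which is the exit.
    Conversely a path that has visited heights 1 and [m] has visited all
    heights in between, so that only [i] is missing until the exit. *)
Lemma first_covered_exit i n : (1 <= i <= m)%N ->
  unit_steps n (X^~ w) ->
  (first_covered n /\ position m X n w = i) <->
  first_exit n (X^~ w) (m.+1 - i) false false.
Proof.
move=> im xs; set h := height (m.+1 - i) (X^~ w).
have i_le : (i <= m.+1)%N by lia.
have posE j : 0 <= h j -> position m X j w = ((`|h j| + i) %% m.+1)%N.
  exact: position_height.
have hs j : (j < n)%N -> h j.+1 = h j + 1 \/ h j.+1 = h j - 1.
  by move=> jn; rewrite /h heightSr; have [->|->] := xs j jn; [left|right].
have pos_inside j : 0 < h j < m.+1%:Z -> position m X j w <> i.
  move=> hj; rewrite posE; last by lia.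
  move=> E; have : (`|h j| + i == 0 + i %[mod m.+1])%N.
    by rewrite E add0n modn_small //; lia.
  by rewrite eqn_modDr !modn_small; lia.
have pos_exit j : h j = 0 \/ h j = m.+1%:Z -> position m X j w = i.
  case=> hj; rewrite posE hj //= ?absz_nat ?modnDl modn_small //; lia.
split; last first.
  move=> [H1 H2 [//|[a an ha]] [//|[b bn hb]]].
  have posn := pos_exit n H2; split=> //; split.
    apply/all_visitedP => v vm.
    have [->|vi] := eqVneq v i; first by exists n.
    (* The height of vertex [v], which is not 0 since [v != i]. *)
    pose u := ((v + (m.+1 - i)) %% m.+1)%N.
    have ui : ((u + i) %% m.+1 = v)%N.
      by rewrite /u modnDml -addnA subnK // modnDr modn_small.
    have u_lt : (u < m.+1)%N by rewrite /u ltn_mod.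
    have u_gt0 : (0 < u)%N.
      rewrite lt0n; apply: contra_neqN vi => /eqP u0.
      by rewrite -ui u0 add0n modn_small //; lia.
    have [j jn hj] : exists2 j, (j < n)%N & h j = u%:Z.
      by apply: (heights_between hs an bn ha hb); lia.
    by exists j; [exact: ltnW|rewrite posE hj // absz_nat].
  move=> k /all_visitedP /(_ i) [|j jk posj]; first by lia.
  have [//|kn] := leqP n k; exfalso; apply: (pos_inside j) => //.
  by apply: H1; lia.
move=> [[/all_visitedP cov minn] posn].
have n_gt0 : (0 < n)%N.
  case: (n) posn => [|//]; rewrite /position big_ord0 mod0z /=; lia.
have noti j : (j < n)%N -> position m X j w <> i.
  (* An earlier visit of [i] makes the vertex visited at time [n] redundant. *)
  move=> jn posj; suff : all_visited m X n.-1 w by move/minn; lia.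
  apply/all_visitedP => v /cov [k kn <-].
  have [->|kN] := eqVneq k n; first by exists j; [lia|rewrite posj posn].
  by exists k => //; lia.
have inside j : (j < n)%N -> 0 < h j < m.+1%:Z.
  elim: j => [|j IH] jn; first by rewrite /h height0; lia.
  have hj := IH (ltnW jn).
  have hS : 0 <= h j.+1 <= m.+1%:Z by have := hs j (ltnW jn); lia.
  have [h0|h0] := eqVneq (h j.+1) 0.
    by case: (noti _ jn); apply: pos_exit; left.
  have [hM|hM] := eqVneq (h j.+1) m.+1%:Z.
    by case: (noti _ jn); apply: pos_exit; right.
  by lia.
have reach u : (0 < u <= m)%N -> exists2 j, (j < n)%N & h j = u%:Z.
  move=> um; have [|j jn posj] := cov ((u + i) %% m.+1)%N.
    by rewrite -ltnS ltn_mod.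
  have modK a b : (a < m.+1)%N -> (b < m.+1)%N ->
      ((a + i) %% m.+1 = (b + i) %% m.+1)%N -> a = b.
    by move=> am bm /eqP; rewrite eqn_modDr !modn_small // => /eqP.
  have [jN|jN] := eqVneq j n.
    have : u = 0%N; last by lia.
    by apply: modK => //; [lia|rewrite -posj jN posn add0n modn_small //; lia].
  have {jN}jn : (j < n)%N by lia.
  exists j => //; have hj := inside j jn.
  have : `|h j|%N = u; last by lia.
  by apply: modK; [lia|lia|rewrite -posE //; lia].
split=> //; last 2 first.
- by right; apply: reach; lia.
- by right; apply: reach; lia.
have hn : 0 <= h n <= m.+1%:Z.
  case: n n_gt0 inside hs {minn posn cov noti reach xs} => // k _ ins hs.
  by have := ins k (ltnSn k); have := hs k (ltnSn k); lia.
have [e|h0] := eqVneq (h n) 0; first by left.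
have [e|hM] := eqVneq (h n) m.+1%:Z; first by right.
by case: (pos_inside n) => //; lia.
Qed.

End position.

End paths.

(** * Probabilities of covering events *)

Section cover_time.
Variables (R : realType) (T : Type) (m : nat) (X : nat -> T -> int).

Lemma exists_first_covered k w : all_visited m X k w ->
  exists n, first_covered m X w n.
Proof.
move=> vk; have ex : exists n, `[< all_visited m X n w >].
  by exists k; apply/asboolP.
case: (ex_minnP ex) => n /asboolP vn minn; exists n; split=> // j vj.
by apply: minn; apply/asboolP.
Qed.

Lemma cover_time_first n w : first_covered m X w n ->
  cover_time m X w = n%:R%:E :> \bar R.
Proof.
move=> [vn minn]; apply/eqP; rewrite eq_le; apply/andP; split.
  by apply: ereal_inf_lbound; exists n.
apply: le_ereal_inf_tmp => _ [k vk <-].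
by rewrite lee_fin ler_nat; exact: minn.
Qed.

Lemma cover_time_infinite w : (forall n, ~ first_covered m X w n) ->
  cover_time m X w = +oo%E :> \bar R.
Proof.
move=> nocov; rewrite /cover_time.
rewrite (_ : [set _%:E | _ in _] = set0) ?ereal_inf0 //.
apply/seteqP; split=> [t [k vk _]|//].
by case: (exists_first_covered vk) => n /nocov.
Qed.

Lemma cover_timeP n w :
  cover_time m X w = n%:R%:E :> \bar R <-> first_covered m X w n.
Proof.
split; last exact: cover_time_first.
move=> Vn; have [[k ck]|nocov] := pselect (exists k, first_covered m X w k).
  suff -> : n = k by [].
  apply/eqP; rewrite -(eqr_nat R); apply/eqP.
  by apply: EFin_inj; rewrite -Vn; exact: cover_time_first.
move: Vn; rewrite cover_time_infinite // => k ck.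
by apply: nocov; exists k.
Qed.

Lemma first_covered_unique w n k :
  first_covered m X w n -> first_covered m X w k -> n = k.
Proof.
by move=> [vn minn] [vk mink]; apply/eqP; rewrite eqn_leq minn //= mink.
Qed.

(** Equality of the first [n] steps: events that respect it are decided at
    time [n], which gives their measurability. *)
Definition agree n w w' := forall k, (k < n)%N -> X k w = X k w'.

Lemma agreeW n k w w' : (k <= n)%N -> agree n w w' -> agree k w w'.
Proof. by move=> kn ag j jk; apply: ag; exact: leq_trans kn. Qed.

Lemma position_agree n w w' : agree n w w' ->
  position m X n w = position m X n w'.
Proof.
move=> ag; rewrite /position; congr `|(_ %% _)%Z|%N.
by apply: eq_bigr => k _; apply: ag.
Qed.

Lemma all_visited_agree n w w' : agree n w w' ->
  all_visited m X n w -> all_visited m X n w'.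
Proof.
move=> ag /all_visitedP vis; apply/all_visitedP => v /vis [j jn <-].
by exists j => //; apply/esym/position_agree/(agreeW jn).
Qed.

Lemma agree_sym n w w' : agree n w w' -> agree n w' w.
Proof. by move=> ag k kn; rewrite ag. Qed.

Lemma first_covered_agree n w w' : agree n w w' ->
  first_covered m X w n -> first_covered m X w' n.
Proof.
move=> ag [vn minn]; split; first exact: all_visited_agree vn.
move=> k vk; have [//|kn] := leqP n k.
have : all_visited m X k w.
  by apply: all_visited_agree vk; apply/agree_sym/(agreeW (ltnW kn)).
by move/minn; rewrite leqNgt kn.
Qed.

End cover_time.

Lemma eq_accept m n x x' y lo hi :
  (forall k, (k < n)%N -> x k = x' k) ->
  accept m n x y lo hi = accept m n x' y lo hi.
Proof.
elim: n x x' y lo hi => [//|n IH] x x' y lo hi xx' /=.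
rewrite xx' //; congr (_ && (_ && _ || _ && _)); apply: IH => k kn;
exact: xx'.
Qed.

Section walk_probability.
Variables (R : realType) (d : measure_display) (T : measurableType d).
Variables (P : probability T R) (m : nat) (p q : R).
Variable X : nat -> {RV P >-> int}.
Hypothesis hindep : mutually_independent X.
Hypothesis hcw : forall k, P (X k @^-1` [set 1%Z]) = p%:E.
Hypothesis hccw : forall k, P (X k @^-1` [set (-1)%Z]) = q%:E.
Hypothesis pq1 : p + q = 1.

Let measurable_step k (z : int) : measurable (X k @^-1` [set z]).
Proof. by apply: measurable_funPTI. Qed.

Definition cylinder (s : seq int) : set T :=
  [set w | mkseq (X^~ w) (size s) = s].

Lemma cylinderE s :
  cylinder s = \bigcap_(k in `I_(size s)) (X k @^-1` [set nth 0 s k]).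
Proof.
apply/seteqP; split=> w /=.
  by move=> ws k /= ks; rewrite -ws nth_mkseq.
move=> ws; rewrite /cylinder /=.
apply: (@eq_from_nth _ 0); rewrite size_mkseq // => k ks.
by rewrite nth_mkseq //; exact: ws.
Qed.

Lemma measurable_cylinder s : measurable (cylinder s).
Proof. by rewrite cylinderE; apply: bigcap_measurableType => k _. Qed.

(** Steps take countably many values, so an event decided at time [n] is a
    countable union of cylinders. *)
Lemma measurable_finite_horizon n (A : set T) :
  (forall w w', agree X n w w' -> A w -> A w') -> measurable A.
Proof.
move=> Aag.
have -> : A = \bigcup_(s : seq int)
    [set w | [/\ size s = n, cylinder s w & exists2 w', A w' & cylinder s w']].
  apply/seteqP; split=> [w Aw|w [s _ [sn sw [w' Aw' sw']]]].
    exists (mkseq (X^~ w) n) => //=; rewrite size_mkseq; split=> //.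
      by rewrite /cylinder /= size_mkseq.
    by exists w => //; rewrite /cylinder /= size_mkseq.
  apply: Aag Aw' => k kn; move: sw sw'; rewrite /cylinder /= sn => sw sw'.
  have := congr1 (nth 0 ^~ k) sw; have := congr1 (nth 0 ^~ k) sw'.
  by rewrite !nth_mkseq // => -> ->.
apply: countable_bigcupT_measurable => // s.
have [sn|sn] := pselect (size s = n); last first.
  by rewrite (_ : [set _ | _] = set0) //; apply/seteqP; split=> // w [].
have [ex|nex] := pselect (exists2 w', A w' & cylinder s w'); last first.
  by rewrite (_ : [set _ | _] = set0) //; apply/seteqP; split=> // w [].
rewrite (_ : [set _ | _] = cylinder s); first exact: measurable_cylinder.
by apply/seteqP; split=> w; [case|move=> ws; split].
Qed.

Definition weight (z : int) : R := if z == 1 then p else q.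

Lemma cylinder_prob s : (forall z, z \in s -> z = 1 \/ z = -1) ->
  P (cylinder s) = (\prod_(z <- s) weight z)%:E.
Proof.
move=> s1; rewrite cylinderE.
have -> : `I_(size s) = [set` [fset k in iota 0 (size s)]%fset].
  by apply/seteqP; split=> k /=; rewrite !inE mem_iota add0n.
rewrite hindep; last by [].
rewrite (perm_big (iota 0 (size s))) /=; last first.
  by apply: uniq_perm; rewrite ?fset_uniq ?iota_uniq // => k; rewrite !inE.
rewrite -prodEFin [RHS](big_nth 0) /index_iota subn0.
apply: eq_big_seq => k; rewrite mem_iota add0n => ks.
have [->|->] := s1 _ (mem_nth 0 ks); first exact: hcw.
exact: hccw.
Qed.

Definition accepted s n y lo hi : set T :=
  [set w | cylinder s w /\ accept m n (fun k => X (size s + k)%N w) y lo hi].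

Lemma measurable_accepted s n y lo hi : measurable (accepted s n y lo hi).
Proof.
apply: (@measurable_finite_horizon (size s + n)%N) => w w' ag [ws acc]; split.
  rewrite /cylinder /= -[RHS]ws; apply/eq_in_map => k.
  by rewrite mem_iota => ks; apply/esym/ag; lia.
by rewrite -(@eq_accept _ _ (fun k => X (size s + k)%N w)) // => k kn;
   apply: ag; lia.
Qed.

Lemma cylinder_rcons s z w :
  cylinder (rcons s z) w <-> cylinder s w /\ X (size s) w = z.
Proof.
rewrite /cylinder /= size_rcons mkseqS; split=> [/rcons_inj[-> ->]//|].
by move=> [-> ->].
Qed.

(** Independence enters through the prefix [s] only: extending it by one step
    multiplies its probability by [p] or [q], which is the recursion of
    [exit_prob]. *)
Lemma accept_prob n s y lo hi :
  (forall z, z \in s -> z = 1 \/ z = -1) ->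
  P (accepted s n y lo hi) =
  ((\prod_(z <- s) weight z) * exit_prob m p q n y lo hi)%:E.
Proof.
elim: n s y lo hi => [|n IH] s y lo hi s1.
  rewrite /accepted /=; case: (absorbed m y && (lo && hi)).
    rewrite mulr1 -cylinder_prob //; congr (P _).
    by apply/seteqP; split=> w; [case|].
  rewrite mulr0 (_ : [set _ | _] = set0) ?measure0 //.
  by apply/seteqP; split=> w // [].
rewrite /=; have [yabs|yN] := boolP (absorbed m y).
  rewrite mulr0 (_ : accepted _ _ _ _ _ = set0) ?measure0 //.
  by apply/seteqP; split=> w // -[_ /=]; rewrite yabs.
set lo' := lo || _; set hi' := hi || _.
have -> : accepted s n.+1 y lo hi =
    accepted (rcons s 1) n y.+1 lo' hi' `|`
    accepted (rcons s (-1)) n y.-1 lo' hi'.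
  have shift w : (fun k => X (size s + k.+1)%N w) =
      (fun k => X ((size s).+1 + k)%N w).
    by apply/funext => k; rewrite addnS.
  rewrite /accepted /= !size_rcons yN /=.
  apply/seteqP; split=> w /=; rewrite !cylinder_rcons addn0 shift.
    by move=> [ws /orP[]/andP[/eqP -> acc]]; [left|right].
  by case=> -[[ws ->] acc]; split=> //; rewrite acc ?orbT.
have s1' z : z = 1 \/ z = -1 ->
    forall z', z' \in rcons s z -> z' = 1 \/ z' = -1.
  by move=> z1 z'; rewrite mem_rcons inE => /orP[/eqP ->|/s1].
transitivity (P (accepted (rcons s 1%R) n y.+1 lo' hi') +
              P (accepted (rcons s (-1)%R) n y.-1 lo' hi'))%E; last first.
  rewrite !IH; [|by apply: s1'; right|by apply: s1'; left].
  by rewrite -EFinD -!cats1 !big_cat !big_seq1 /= /weight /=; congr EFin; ring.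
apply: measureU; [exact: measurable_accepted|exact: measurable_accepted|].
apply/seteqP; split=> w //; rewrite /accepted /= !cylinder_rcons.
by move=> [[[_ ->] _] [[_]]].
Qed.

(** Outside this null set all steps are 1 or -1, so that the walk is a
    nearest-neighbour path. *)
Definition irregular : set T :=
  \bigcup_k ~` (X k @^-1` [set 1%Z] `|` X k @^-1` [set (-1)%Z]).

Lemma measurable_irregular : measurable irregular.
Proof.
apply: bigcup_measurable => k _; apply: measurableC.
by apply: measurableU.
Qed.

Lemma irregular_null : P irregular = 0%E.
Proof.
apply/negligibleP; first exact: measurable_irregular.
apply: negligible_bigcup => k.
have mU := measurableU _ _ (measurable_step k 1) (measurable_step k (-1)).
apply/negligibleP; first exact: measurableC.
set U := (_ `|` _) in mU *; transitivity (1 - P U)%E.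
  exact: probability_setC.
rewrite (_ : P U = 1%:E) ?subee //; rewrite -pq1 EFinD -(hcw k) -(hccw k).
apply: measureU => //.
by apply/seteqP; split=> w // -[/= ->].
Qed.

Lemma unit_stepsP w n : ~ irregular w -> unit_steps n (fun k => X k w).
Proof.
move=> reg k _; apply: contrapT => Xk; apply: reg; exists k => // -[e|e];
by apply: Xk; [left|right].
Qed.

Lemma prob_le_regular (A B : set T) : measurable A -> measurable B ->
  (forall w, ~ irregular w -> A w -> B w) -> (P A <= P B)%E.
Proof.
move=> mA mB AB; have mI := measurable_irregular.
have mU := measurableU _ _ mB mI.
apply: (@le_trans _ _ (P (B `|` irregular))).
  apply: le_measure; rewrite ?inE // => w Aw.
  by have [?|?] := pselect (irregular w); [right|left; exact: AB].
apply: (@le_trans _ _ (P B + P irregular)%E); first exact: measureU2.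
by rewrite irregular_null adde0.
Qed.

Lemma prob_eq_regular (A B : set T) : measurable A -> measurable B ->
  (forall w, ~ irregular w -> A w <-> B w) -> P A = P B.
Proof.
move=> mA mB AB; apply/eqP; rewrite eq_le.
by rewrite !prob_le_regular // => w /AB[].
Qed.

Definition last_at i n : set T :=
  [set w | first_covered m X w n /\ position m X n w = i].

Lemma measurable_last_at i n : measurable (last_at i n).
Proof.
apply: (@measurable_finite_horizon n) => w w' ag [cw pw]; split.
  exact: first_covered_agree cw.
by rewrite -(position_agree _ ag).
Qed.

Lemma last_at_prob i n : (1 <= i <= m)%N ->
  P (last_at i n) = (exit_prob m p q n (m.+1 - i) false false)%:E.
Proof.
move=> im; transitivity (P (accepted [::] n (m.+1 - i) false false)).
  apply: prob_eq_regular; [exact: measurable_last_at| |].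
    exact: measurable_accepted.
  move=> w reg; have xs := @unit_stepsP w n reg.
  apply: iff_trans (first_covered_exit im xs) _.
  apply: iff_trans (iff_sym (acceptP _ _ _ xs)) _; first lia.
  by split=> [acc|[]//].
by rewrite accept_prob // big_nil mul1r.
Qed.

(** The last vertex visited is one of [1], ..., [m], vertex 0 being visited at
    time 0; for vertex [i] the starting height is [m.+1 - i], so the starting
    heights are [1], ..., [m] as well. *)
Lemma first_covered_prob n : (0 < m)%N ->
  P [set w | first_covered m X w n] =
  (\sum_(j < m) exit_prob m p q n j.+1 false false)%:E.
Proof.
move=> m0.
have -> : [set w | first_covered m X w n] =
    \bigcup_(i in `I_m) last_at i.+1 n.
  apply/seteqP; split=> w; last by case=> i _ [].
  move=> /= cw; have := position_lt m X w n.
  case pos: (position m X n w) => [|i] im; last by exists i => //=.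
  exfalso; case: n cw pos => [|n] [vis minn] pos.
    have /all_visitedP /(_ 1%N m0) [j] := vis.
    by rewrite leqn0 => /eqP ->; rewrite pos.
  suff /minn : all_visited m X n w by rewrite ltnn.
  apply/all_visitedP => v vm; have /all_visitedP /(_ v vm) [j jn <-] := vis.
  have [->|jN] := eqVneq j n.+1; last by exists j => //; lia.
  by exists 0%N => //; rewrite pos /position big_ord0 mod0z.
rewrite measure_fin_bigcup //; last 2 first.
- move=> i j _ _ [w [[_ pi] [_ pj]]].
  by move: pi; rewrite pj => -[].
- by move=> i _; exact: measurable_last_at.
rewrite -fsbig_ord -sumEFin [RHS](reindex_inj rev_ord_inj).
apply: eq_bigr => i _ /=; have im := ltn_ord i.
by rewrite last_at_prob //= subnSK // subSS.
Qed.

End walk_probability.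

Section stopped_sum.
Variables (R : realType) (d : measure_display) (T : measurableType d).
Variables (P : {measure set T -> \bar R}).

Lemma nneseries_EFin_cvg (u : nat -> \bar R) (v : R^nat) (l : R) :
  (forall n, u n = (v n)%:E) ->
  (fun N => \sum_(n < N) v n) @ \oo --> l -> (\sum_(n <oo) u n = l%:E)%E.
Proof.
move=> uv vl; apply/cvg_lim => //.
rewrite (_ : (fun N => _) = (fun N => (\sum_(n < N) v n)%:E)).
  by apply: cvg_EFin; [exact: nearW|].
apply/funext => N; rewrite big_mkord -sumEFin; apply: eq_bigr => n _.
exact: uv.
Qed.

(** A time that equals [n] on [B n] is integrated over the union of the [B n]
    as a series; [b n] stands for the real number [P (B n)]. *)
Lemma measure_stopped (B : nat -> set T) (V : T -> \bar R) (b : R^nat)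
    (g h : R) :
  (forall n, measurable (B n)) -> trivIset setT B ->
  (forall n w, B n w -> V w = n%:R%:E) ->
  (forall n, P (B n) = (b n)%:E) ->
  (fun N => \sum_(n < N) b n) @ \oo --> g ->
  (fun N => \sum_(n < N) n%:R * b n) @ \oo --> h ->
  [/\ P (\bigcup_n B n) = g%:E, measurable_fun (\bigcup_n B n) V &
      (\int[P]_(w in \bigcup_n B n) V w = h%:E)%E].
Proof.
move=> mB tB VB PB bg bh.
have mV : measurable_fun (\bigcup_n B n) V.
  apply/measurable_fun_bigcup => // n.
  by apply: (eq_measurable_fun (cst n%:R%:E)) => // w; rewrite inE => /VB.
split=> //.
  rewrite measure_semi_bigcup //; last exact: bigcup_measurable.
  exact: nneseries_EFin_cvg bg.
rewrite ge0_integral_bigcup //; last first.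
  by move=> w [n _ /VB ->]; rewrite lee_fin.
apply: nneseries_EFin_cvg bh => n.
rewrite (eq_integral (cst n%:R%:E)); last by move=> w; rewrite inE => /VB.
by rewrite integral_cst // PB -EFinM.
Qed.

End stopped_sum.

(** * The integral of the cover time *)

Section cover_expectation.
Variables (R : realType) (d : measure_display) (T : measurableType d).
Variables (P : probability T R) (m : nat) (p q : R).
Variable X : nat -> {RV P >-> int}.
Hypothesis hindep : mutually_independent X.
Hypothesis hcw : forall k, P (X k @^-1` [set 1%Z]) = p%:E.
Hypothesis hccw : forall k, P (X k @^-1` [set (-1)%Z]) = q%:E.
Hypotheses (p0 : 0 < p) (q0 : 0 < q) (pq1 : p + q = 1).
Variables g h : bool -> bool -> nat -> R.
Hypothesis gsys : phase_system m p q g (fun _ _ _ => 0) true.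
Hypothesis hsys : phase_system m p q h g false.

Let V : T -> \bar R := cover_time m X.

Lemma last_visitedE i : last_visited m X R i = \bigcup_n last_at m X i n.
Proof.
apply/seteqP; split=> w.
  by move=> [n [/cover_timeP cw pw]]; exists n.
by move=> [n _ [cw pw]]; exists n; split=> //; apply/cover_timeP.
Qed.

Lemma trivIset_first_covered (B : nat -> set T) :
  (forall n, B n `<=` [set w | first_covered m X w n]) -> trivIset setT B.
Proof.
by move=> BF i j _ _ [w [/BF Bi /BF Bj]]; exact: first_covered_unique Bi Bj.
Qed.

Lemma last_visited_mass_time i : (1 <= i <= m)%N ->
  P (last_visited m X R i) = (g false false (m.+1 - i))%:E /\
  (\int[P]_(w in last_visited m X R i) V w)%E =
    (h false false (m.+1 - i))%:E.
Proof.
move=> im; have yr : (0 < m.+1 - i <= m)%N by lia.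
have ym : (m.+1 - i <= m.+1)%N by lia.
have [] := @measure_stopped _ _ _ P (last_at m X i) V
  (fun n => exit_prob m p q n (m.+1 - i) false false)
  (g false false (m.+1 - i)) (h false false (m.+1 - i)).
- by move=> n; exact: measurable_last_at.
- by apply: trivIset_first_covered => n w [].
- by move=> n w [cw _]; exact: cover_time_first.
- by move=> n; exact: last_at_prob.
- by rewrite -(state_value_start gsys yr); exact: exit_mass_cvg.
- by rewrite -(state_value_start hsys yr); apply: exit_time_cvg gsys hsys _.
by rewrite last_visitedE.
Qed.

(** The total mass being 1, the cover time is almost surely finite, and its
    integral is that over the event where it is finite. *)
Lemma cover_time_integral : (0 < m)%N ->
  \sum_(j < m) g false false j.+1 = 1 ->
  (\int[P]_w V w)%E = (\sum_(j < m) h false false j.+1)%:E.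
Proof.
move=> m0 g1; pose B n : set T := [set w | first_covered m X w n].
have mB n : measurable (B n).
  apply: (@measurable_finite_horizon _ _ _ P X n) => w w'.
  exact: first_covered_agree.
have [] := @measure_stopped _ _ _ P B V
  (fun n => \sum_(j < m) exit_prob m p q n j.+1 false false)
  1 (\sum_(j < m) h false false j.+1) mB.
- by apply: trivIset_first_covered => n w.
- by move=> n w cw; exact: cover_time_first.
- by move=> n; exact: first_covered_prob.
- rewrite -g1.
  rewrite (_ : (fun _ => _) = (fun N => \sum_(j < m)
      \sum_(n < N) exit_prob m p q n j.+1 false false)).
    apply: cvg_big => [|j _]; first exact: add_continuous.
    rewrite -(state_value_start gsys (ltn_ord j : 0 < j.+1 <= m)%N).
    by apply: exit_mass_cvg => //; exact: (ltnW (ltn_ord j)).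
  by apply/funext => N; rewrite exchange_big.
- rewrite (_ : (fun _ => _) = (fun N => \sum_(j < m)
      \sum_(n < N) n%:R * exit_prob m p q n j.+1 false false)).
    apply: cvg_big => [|j _]; first exact: add_continuous.
    rewrite -(state_value_start hsys (ltn_ord j : 0 < j.+1 <= m)%N).
    by apply: exit_time_cvg gsys hsys _ => //; exact: (ltnW (ltn_ord j)).
  apply/funext => N; rewrite exchange_big; apply: eq_bigr => n _.
  by rewrite mulr_sumr.
set D := \bigcup_n B n => PD mVD intD; rewrite -intD.
have mD : measurable D by exact: bigcup_measurable.
have mDC : measurable (~` D) by exact: measurableC.
have PDC : P (~` D) = 0%E.
  transitivity (1 - P D)%E; first exact: probability_setC.
  by rewrite PD subee.
have mV : measurable_fun (D `|` ~` D) V.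
  apply/measurable_funU => //; split=> //.
  apply: (eq_measurable_fun (cst +oo%E)) => // w; rewrite inE => nDw.
  by apply/esym/cover_time_infinite => n cw; apply: nDw; exists n.
have V0 w : (0 <= V w)%E.
  by apply: le_ereal_inf_tmp => _ [n _ <-]; rewrite lee_fin.
rewrite -(setUv D) ge0_integral_setU //; last first.
  by apply/disj_setPCl.
rewrite [X in (_ + X)%E]null_set_integral ?adde0 //.
by move/measurable_funU: mV => /(_ mD mDC) [].
Qed.

End cover_expectation.

(** * The conditional and total expectations *)

Theorem theorem3p3 (R : realType) (d : measure_display) (T : measurableType d)
    (P : probability T R) (m : nat) (p q r : R) (X : nat -> {RV P >-> int})
    (hm : (2 <= m)%N) (hp : 0 < p < 1) (hq : q = 1 - p) (hr : r = q / p)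
    (hindep : mutually_independent X)
    (hcw : forall k : nat, P (X k @^-1` [set 1%Z]) = p%:E)
    (hccw : forall k : nat, P (X k @^-1` [set (-1)%Z]) = q%:E) :
  let V : T -> \bar R := cover_time m X in
  let L (i : nat) : set T := last_visited m X R i in
  (forall i : nat, (1 <= i <= m)%N ->
    (0 < P (L i))%E /\
    cond_expectation P (L i) V =
      (if r == 1 then
         3^-1 * (m%:R - 1) * (m%:R + 1) + (m%:R + 1 - i%:R) * i%:R
       else
         (r + 1) / (r - 1) *
         (m%:R + i%:R - 1 - 2 / (r - 1) + 2 * m%:R / (r ^+ m - 1)
          - (m%:R + 1) * ((r ^+ i - 1) / (r ^+ m.+1 - 1))))%:E) /\
  (\int[P]_w V w)%E =
    (if r == 1 then
       m%:R * (m%:R + 1) / 2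
     else
       (r + 1) / (r - 1) *
       (m%:R - (r - 1)^-1 - m%:R ^+ 2 / (r ^+ m - 1)
        + (m%:R + 1) ^+ 2 / (r ^+ m.+1 - 1)))%:E.
Proof.
move=> V L; have m0 : (0 < m)%N by lia.
case/andP: (hp) => p0 p1; have q0 : 0 < q by rewrite hq; lra.
have pq1 : p + q = 1 by rewrite hq; ring.
have r0 : 0 < r by rewrite hr divr_gt0.
have pN0 := lt0r_neq0 p0.
have pE : (1 + r)^-1 = p by rewrite hr hq; field; rewrite pN0 subrKC oner_neq0.
have qE : r / (1 + r) = q by rewrite pE hr mulfVK.
have conditional g h : phase_system m p q g (fun _ _ _ => 0) true ->
    phase_system m p q h g false -> forall i, (1 <= i <= m)%N ->
    0 < g false false (m.+1 - i)%N ->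
    (0 < P (L i))%E /\ cond_expectation P (L i) V =
      (h false false (m.+1 - i)%N / g false false (m.+1 - i)%N)%:E.
  move=> gsys hsys i im g_gt0.
  have [PL VL] := last_visited_mass_time hindep hcw hccw p0 q0 pq1 gsys hsys im.
  split; first by rewrite PL lte_fin.
  by rewrite /cond_expectation VL PL inver gt_eqF.
have [r1|rN1] := eqVneq r 1.
  have p2 : p = 2^-1 by rewrite -pE r1.
  have q2 : q = 2^-1 by rewrite -qE r1 mul1r.
  have gsys := sym_mass_system R m0; have hsys := sym_time_system R m0.
  rewrite -[X in phase_system _ X _]p2 in gsys hsys.
  rewrite -[X in phase_system _ _ X]q2 in gsys hsys.
  split; last first.
    rewrite -sum_sym_time //.
    apply: (cover_time_integral hindep hcw hccw p0 q0 pq1 gsys hsys m0).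
    exact: sum_sym_mass.
  move=> i im; rewrite -sym_conditional_time //.
  by apply: conditional => //; rewrite invr_gt0 ltr0n.
have gsys := asym_mass_system r0 rN1 m0.
have hsys := asym_time_system r0 rN1 m0.
rewrite qE pE in gsys hsys.
split; last first.
  rewrite -sum_asym_time //.
  apply: (cover_time_integral hindep hcw hccw p0 q0 pq1 gsys hsys m0).
  exact: sum_asym_mass.
move=> i im; rewrite -asym_conditional_time //.
by apply: conditional => //; exact: asym_mass_gt0.
Qed.
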